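(* For all $n\ge 3$, $\mathrm{r}_n(2413)=2\,\mathrm{r}_{n-1}(2413)+2\,\mathrm{r}_{n-2}(2413)$.
   Context: $\mathcal{S}_n$ is the set of permutations of $[n]$, $\pi^r$ the reversal of $\pi$. A word $w$ contains $\rho\in\mathcal{S}_k$ if some subsequence $w_{i_1}\cdots w_{i_k}$ ($i_1<\cdots<i_k$) satisfies $w_{i_a}\le w_{i_b}$ iff $\rho_a\le\rho_b$; otherwise it avoids $\rho$. $\mathcal{R}_n=\{\pi\pi^r:\pi\in\mathcal{S}_n\}$ (concatenation of $\pi$ with its reversal), and $\mathrm{r}_n(\rho)$ is the number of members of $\mathcal{R}_n$ avoiding $\rho$; here $\mathrm{r}_1=1$, $\mathrm{r}_2=2$. *)

(* Defs.v *)
From mathcomp Require Import all_boot all_fingroup.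

Set Implicit Arguments.
Unset Strict Implicit.
Unset Printing Implicit Defensive.

(* Letters and positions are 0-based: [n] is represented by 'I_n, and a word
   of length m over [n] is an m.-tuple 'I_n. *)

Definition contains (m n k : nat) (w : m.-tuple 'I_n) (rho : 'S_k) : bool :=
  [exists i : {ffun 'I_k -> 'I_m},
    [forall a : 'I_k, forall b : 'I_k, (a < b) ==> (i a < i b)] &&
    [forall a : 'I_k, forall b : 'I_k,
      (tnth w (i a) <= tnth w (i b)) == (rho a <= rho b)]].

Definition avoids (m n k : nat) (w : m.-tuple 'I_n) (rho : 'S_k) : bool :=
  ~~ contains w rho.

Definition word_of_perm (n : nat) (s : 'S_n) : n.-tuple 'I_n :=
  [tuple s i | i < n].

Definition reverse_doubles (n : nat) : {set (n + n).-tuple 'I_n} :=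
  [set [tuple of word_of_perm s ++ rev (word_of_perm s)] | s : 'S_n].

Definition r (n k : nat) (rho : 'S_k) : nat :=
  #|[set w in reverse_doubles n | avoids w rho]|.

(* 2413 in one-line notation, shifted down by one. *)
Definition fun2413 (a : 'I_4) : 'I_4 :=
  tnth [tuple @Ordinal 4 1 isT; @Ordinal 4 3 isT;
              @Ordinal 4 0 isT; @Ordinal 4 2 isT] a.

Lemma fun2413_inj : injective fun2413.
Proof.
  by move=> [[|[|[|[|a]]]] ha] [[|[|[|[|b]]]] hb] H; apply: val_inj;
    move: H => /(congr1 val).
Qed.

Definition perm2413 : 'S_4 := perm fun2413_inj.

(* Main.v *)
(** For each letter of [pi], all letters at distance at least two to its right
    must lie on the same side of it: [pi pi^r] contains 2413 exactly when [pi]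
    contains one of the eight patterns obtained by removing the letters of 2413
    one by one from either end, and these are the patterns of length four
    starting with 2 (resp. 3) whose next letter is not 1 (resp. 4).  Hence a
    good word on an interval of [n >= 3] letters starts with its minimum, with
    its maximum, with its two smallest letters in decreasing order, or with its
    two largest letters in increasing order, and the remaining letters form an
    arbitrary good word on an interval. *)

Require Import Defs.
From mathcomp Require Import all_boot all_fingroup.
From mathcomp Require Import zify.

Set Implicit Arguments.
Unset Strict Implicit.
Unset Printing Implicit Defensive.

(** * Good words and the triples of positions that violate goodness *)

Fixpoint good (w : seq nat) : bool :=
  if w is x :: t then
    (all (ltn x) (behead t) || all (gtn x) (behead t)) && good t
  else true.

(** Indices count from the start of [t], so [0 < j] excludes the right neighbour of the letter
    preceding [t]. *)
Lemma all_beheadPn (P : pred nat) (t : seq nat) :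
  reflect (exists2 j, 0 < j < size t & ~~ P (nth 0 t j))
          (~~ all P (behead t)).
Proof.
apply: (iffP idP) => [/allPn[y yt Py]|[j jt]].
  exists (index y (behead t)).+1; last by rewrite -nth_behead nth_index.
  by move: yt; rewrite -index_mem size_behead /=; lia.
apply: contra => /(all_nthP 0)/(_ j.-1); rewrite nth_behead size_behead.
by rewrite prednK; [apply|]; lia.
Qed.

Lemma goodPn (w : seq nat) : uniq w ->
  ~~ good w <-> exists i j k,
    [/\ i.+1 < j < size w, i.+1 < k < size w &
        nth 0 w j < nth 0 w i < nth 0 w k].
Proof.
elim: w => [|x t IH] /=; first by move=> _; split=> // -[i [j [k []]]]; lia.
move=> /andP[xt /IH {}IH]; rewrite negb_and negb_or; split.
- case/orP=> [/andP[/all_beheadPn[j jt jx] /all_beheadPn[k kt kx]]|].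
  (* Failure of [good] yields only weak inequalities; distinctness of the letters makes them
     strict. *)
  + have neq p : 0 < p < size t -> nth 0 t p <> x.
      by case/andP=> _ pt E; rewrite -E mem_nth in xt.
    exists 0, j.+1, k.+1 => /=; have := neq j jt; have := neq k kt.
    by move: jx kx => /= jx kx; split; lia.
  + by case/IH=> i [j [k [ij ik H]]]; exists i.+1, j.+1, k.+1.
- case=> -[|i] [[|j] [[|k] [ij ik]]] //= H; last first.
    by apply/orP; right; apply/IH; exists i, j, k.
  by apply/orP; left; apply/andP; split; apply/all_beheadPn;
    [exists j | exists k]; move: H => /=; lia.
Qed.

(** * Words on an interval and the removal of extreme letters *)

Definition interval_word (a n : nat) (w : seq nat) : Prop :=
  uniq w /\ forall y : nat, (y \in w) = (a <= y < a + n).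

Lemma interval_word_perm (a n : nat) (w : seq nat) :
  interval_word a n w -> perm_eq w (iota a n).
Proof.
case=> uw mw; apply: uniq_perm => // [|y]; first exact: iota_uniq.
by rewrite mem_iota mw.
Qed.

Lemma interval_word_size (a n : nat) (w : seq nat) :
  interval_word a n w -> size w = n.
Proof. by move/interval_word_perm/perm_size; rewrite size_iota. Qed.

Lemma interval_word_min (a n : nat) (t : seq nat) :
  interval_word a n.+1 (a :: t) <-> interval_word a.+1 n t.
Proof.
rewrite /interval_word /=; split=> -[].
- move=> /andP[at_ ut] mt; split=> // y; have := mt y; rewrite in_cons.
  by case: eqVneq => [->|] /=; rewrite ?(negPf at_); lia.
- move=> ut mt; rewrite ut mt andbT; split; first by lia.
  by move=> y; rewrite in_cons mt; lia.
Qed.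

Lemma interval_word_max (a n : nat) (t : seq nat) :
  interval_word a n.+1 (a + n :: t) <-> interval_word a n t.
Proof.
rewrite /interval_word /=; split=> -[].
- move=> /andP[at_ ut] mt; split=> // y; have := mt y; rewrite in_cons.
  by case: eqVneq => [->|] /=; rewrite ?(negPf at_); lia.
- move=> ut mt; rewrite ut mt andbT; split; first by lia.
  by move=> y; rewrite in_cons mt; lia.
Qed.

(** Reduces the two-letter prefixes to removing extreme letters one at a time, the outermost
    first. *)
Lemma interval_word_swap (a n : nat) (x y : nat) (t : seq nat) :
  interval_word a n (x :: y :: t) <-> interval_word a n (y :: x :: t).
Proof.
rewrite /interval_word /= !in_cons !negb_or (eq_sym x y).
have E : [&& (y != x) && (x \notin t), y \notin t & uniq t] =
         [&& (y != x) && (y \notin t), x \notin t & uniq t].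
  by case: (y != x); case: (x \notin t); case: (y \notin t).
by rewrite E; split=> -[-> H]; split=> // z; rewrite -H !in_cons orbCA.
Qed.

Lemma interval_word_min2 (a n : nat) (t : seq nat) :
  interval_word a n.+2 (a.+1 :: a :: t) <-> interval_word a.+2 n t.
Proof. by rewrite interval_word_swap !interval_word_min. Qed.

Lemma interval_word_max2 (a n : nat) (t : seq nat) :
  interval_word a n.+2 (a + n :: a + n.+1 :: t) <-> interval_word a n t.
Proof. by rewrite interval_word_swap !interval_word_max. Qed.

(** * Recursive enumeration of the good words on an interval *)

Fixpoint good_words (n a : nat) : seq (seq nat) :=
  match n with
  | 0 => [:: [::]]
  | 1 => [:: [:: a]]
  | 2 => [:: [:: a; a.+1]; [:: a.+1; a]]
  | ((_.+1 as p).+1 as q).+1 =>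
      map (cons a) (good_words q a.+1) ++
      map (cons (a + q)) (good_words q a) ++
      map (fun t => a.+1 :: a :: t) (good_words p a.+2) ++
      map (fun t => a + p :: a + q :: t) (good_words p a)
  end.

Lemma good_wordsE (n a : nat) : good_words n.+3 a =
  map (cons a) (good_words n.+2 a.+1) ++
  map (cons (a + n.+2)) (good_words n.+2 a) ++
  map (fun t => a.+1 :: a :: t) (good_words n.+1 a.+2) ++
  map (fun t => a + n.+1 :: a + n.+2 :: t) (good_words n.+1 a).
Proof. by []. Qed.

(** The offset only translates letters. The recursion reaches back two lengths, so the induction
    carries two consecutive lengths, here and below. *)
Lemma size_good_words (n a b : nat) :
  size (good_words n a) = size (good_words n b).
Proof.
suff [] : (forall a b, size (good_words n a) = size (good_words n b)) /\
          (forall a b, size (good_words n.+1 a) = size (good_words n.+1 b)) by [].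
elim: n {a b} => [//|[|n] [IH1 IH2]] //; split=> // a b.
by rewrite !good_wordsE !size_cat !size_map (IH2 a.+1 b.+1) (IH2 a b)
  (IH1 a.+2 b.+2) (IH1 a b).
Qed.

Lemma size_good_words_rec (n a : nat) : size (good_words n.+3 a) =
  2 * size (good_words n.+2 a) + 2 * size (good_words n.+1 a).
Proof.
rewrite good_wordsE !size_cat !size_map.
by rewrite (size_good_words n.+2 a.+1 a) (size_good_words n.+1 a.+2 a); lia.
Qed.

(** At length two the one-letter and two-letter prefixes would produce the same words; this is why
    that length is a base case of the enumeration. *)
Lemma uniq_good_words (n a : nat) : uniq (good_words n a).
Proof.
suff [] : (forall a, uniq (good_words n a)) /\
          (forall a, uniq (good_words n.+1 a)) by [].
elim: n {a} => [//|[|n] [IH1 IH2]].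
  by split=> // a /=; rewrite in_cons in_nil !eqseq_cons; lia.
split=> // a; rewrite good_wordsE !cat_uniq !map_inj_uniq ?IH1 ?IH2 //=;
  try by move=> ? ? [].
(* First letters separate the four blocks, except that the last two share theirs when [n = 0]; then
   the second letters [a] and [a + n.+2] differ. *)
rewrite !andbT; apply/and3P; split; apply/hasPn => w; rewrite ?mem_cat.
- by case/or3P=> /mapP[t _ ->]; apply/mapP=> -[u _ []]; lia.
- by case/orP=> /mapP[t _ ->]; apply/mapP=> -[u _ []]; lia.
- by case/mapP=> [t _ ->]; apply/mapP=> -[u _ []]; lia.
Qed.

Lemma good_words_sound (n a : nat) (w : seq nat) :
  w \in good_words n a -> good w /\ interval_word a n w.
Proof.
suff [] : (forall a (w : seq nat), w \in good_words n a -> good w /\ interval_word a n w) /\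
  (forall a (w : seq nat), w \in good_words n.+1 a -> good w /\ interval_word a n.+1 w).
  by move=> H _; exact: H.
elim: n {a w} => [|[|n] [IH1 IH2]].
- split=> a w; rewrite inE => /eqP->; split=> //; split=> // y;
    by rewrite ?in_nil ?inE; lia.
- split=> // a w; rewrite !inE => /orP[] /eqP->; split=> //; split=> [|y];
    by rewrite /= ?inE; lia.
split=> // a w; rewrite good_wordsE !mem_cat; case/or4P=> /mapP[t].
- move=> /IH2[gt it ->]; split; last by apply/interval_word_min.
  rewrite /= gt andbT; apply/orP; left; apply/allP=> y /mem_behead.
  by rewrite it.2 /=; lia.
- move=> /IH2[gt it ->]; split; last by apply/interval_word_max.
  rewrite /= gt andbT; apply/orP; right; apply/allP=> y /mem_behead.
  by rewrite it.2 /=; lia.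
(* The letter [a.+1] is not compared with its neighbour [a], only with the letters of [t], all of
   which are larger. *)
- move=> /IH1[gt it ->]; split; last by apply/interval_word_min2.
  rewrite /= gt andbT; apply/andP; split; apply/orP; left; apply/allP=> y.
    by rewrite it.2 /=; lia.
  by move=> /mem_behead; rewrite it.2 /=; lia.
- move=> /IH1[gt it ->]; split; last by apply/interval_word_max2.
  rewrite /= gt andbT; apply/andP; split; apply/orP; right; apply/allP=> y.
    by rewrite it.2 /=; lia.
  by move=> /mem_behead; rewrite it.2 /=; lia.
Qed.

(** If [x] is below all of [t], only [h] can be smaller than [x]: either [x] is the minimum, or [h]
    is and [x] comes next. The other side is symmetric. *)
Lemma good_head (a n x h : nat) (t : seq nat) :
  interval_word a n.+3 (x :: h :: t) -> good (x :: h :: t) ->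
  [\/ x = a, x = a + n.+2, x = a.+1 /\ h = a |
      x = a + n.+1 /\ h = a + n.+2].
Proof.
move=> [ux mx] /= /andP[side _].
have hx : h != x by case/andP: ux; rewrite in_cons negb_or eq_sym => /andP[].
have /= xr := mx x; have /= hr := mx h.
rewrite !in_cons !eqxx ?orbT /= in xr hr.
case/orP: side => /allP side.
- have := mx a; have := mx a.+1; rewrite !in_cons.
  have [/side|] := boolP (a \in t); have [/side|] := boolP (a.+1 \in t);
    rewrite /= => ? ? ? ?; case: (ltngtP x a) => [||?]; try lia;
    first [by constructor 1 | by move=> ?; constructor 3; lia].
- have := mx (a + n.+2); have := mx (a + n.+1); rewrite !in_cons.
  have [/side|] := boolP (a + n.+2 \in t);
    have [/side|] := boolP (a + n.+1 \in t);
    rewrite /= => ? ? ? ?; case: (ltngtP x (a + n.+2)) => [||?]; try lia;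
    first [by constructor 2 | by move=> ?; constructor 4; lia].
Qed.

Lemma good_words_complete (n a : nat) (w : seq nat) :
  good w -> interval_word a n w -> w \in good_words n a.
Proof.
suff [] : (forall a w, good w -> interval_word a n w -> w \in good_words n a) /\
  (forall a w, good w -> interval_word a n.+1 w -> w \in good_words n.+1 a).
  by move=> H _; exact: H.
elim: n {a w} => [|[|n] [IH1 IH2]].
- split=> a w _ iw; have := interval_word_size iw.
    by move/size0nil->.
  case: w iw => [|x [|]] // [_ mx] _; have := mx x.
  by rewrite !inE eqseq_cons !eqxx andbT; lia.
- split=> // a w _ iw; have := interval_word_size iw.
  case: w iw => [|x [|h []]] // [ux mx] _; have := mx x; have := mx h.
  by move: ux; rewrite /= !inE !eqseq_cons !eqxx ?orbT ?andbT; lia.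
split=> // a w gw iw; have := interval_word_size iw.
case: w gw iw => [|x [|h t]] // gw iw _; rewrite good_wordsE !mem_cat.
have /andP[_ gh] := gw; have /andP[_ gt] := gh.
apply/or4P; case: (good_head iw gw) => [E|E|[E E']|[E E']]; subst x;
  try subst h.
- constructor 1; apply: map_f; apply: IH2 => //; exact/interval_word_min.
- constructor 2; apply: map_f; apply: IH2 => //; exact/interval_word_max.
- constructor 3; apply/mapP; exists t => //.
  by apply: IH1 => //; exact/interval_word_min2.
- constructor 4; apply/mapP; exists t => //.
  by apply: IH1 => //; exact/interval_word_max2.
Qed.

(** * Occurrences of 2413 in a word followed by its reversal *)

Definition values (m n : nat) (w : m.-tuple 'I_n) : seq nat := map val w.

Lemma size_values (m n : nat) (w : m.-tuple 'I_n) : size (values w) = m.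
Proof. by rewrite size_map size_tuple. Qed.

Lemma nth_values (m n : nat) (w : m.-tuple 'I_n) (i : 'I_m) :
  nth 0 (values w) i = tnth w i.
Proof.
by rewrite (nth_map (tnth w i)) ?size_tuple ?ltn_ord // -tnth_nth.
Qed.

Lemma contains2413P (m n : nat) (w : m.-tuple 'I_n) :
  contains w perm2413 <-> exists i0 i1 i2 i3,
    [/\ i0 < i1, i1 < i2, i2 < i3, i3 < m &
      [&& nth 0 (values w) i2 < nth 0 (values w) i0,
          nth 0 (values w) i0 < nth 0 (values w) i3 &
          nth 0 (values w) i3 < nth 0 (values w) i1]].
Proof.
split.
- case/existsP=> i /andP[/forallP inc /forallP ord].
  pose o (k : nat) (lt_k4 : k < 4) := @Ordinal 4 k lt_k4.
  have I (a b : 'I_4) : a < b -> i a < i b.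
    by move: (inc a) => /forallP/(_ b)/implyP.
  have O (a b : 'I_4) : (tnth w (i a) <= tnth w (i b)) = (fun2413 a <= fun2413 b).
    by move: (ord a) => /forallP/(_ b)/eqP->; rewrite !permE.
  exists (i (o 0 isT)), (i (o 1 isT)), (i (o 2 isT)), (i (o 3 isT)).
  split; rewrite ?I ?ltn_ord // !nth_values.
  (* Each strict inequality is the failure of the reversed weak one. *)
  by rewrite !ltnNge !O.
- case=> i0 [i1 [i2 [i3 [h01 h12 h23 h3]]]].
  have h2 := ltn_trans h23 h3; have h1 := ltn_trans h12 h2.
  have h0 := ltn_trans h01 h1.
  rewrite -[i0]/(val (Ordinal h0)) -[i1]/(val (Ordinal h1)).
  rewrite -[i2]/(val (Ordinal h2)) -[i3]/(val (Ordinal h3)) !nth_values.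
  case/and3P=> v20 v03 v31; apply/existsP.
  exists [ffun a => tnth [tuple Ordinal h0; Ordinal h1; Ordinal h2; Ordinal h3] a].
  apply/andP; split; apply/forallP=> a; apply/forallP=> b; rewrite !ffunE.
    case: a b => [[|[|[|[|a]]]] ha] [[|[|[|[|b]]]] hb] //=; lia.
  rewrite !permE /fun2413.
  case: a b => [[|[|[|[|a]]]] ha] [[|[|[|[|b]]]] hb] //=;
    rewrite !(tnth_nth (Ordinal h0)) /=; lia.
Qed.

Lemma nth_cat_rev (w : seq nat) (i : nat) : i < size w + size w ->
  nth 0 (w ++ rev w) i =
  nth 0 w (if i < size w then i else (size w + size w - i).-1).
Proof.
move=> lt_i; rewrite nth_cat; case: ltnP => // le_i.
by rewrite nth_rev; [congr nth|]; lia.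
Qed.

Lemma occurrence2413_good (w : seq nat) : uniq w ->
  (exists i0 i1 i2 i3, let v := nth 0 (w ++ rev w) in
    [/\ i0 < i1, i1 < i2, i2 < i3, i3 < size w + size w &
      [&& v i2 < v i0, v i0 < v i3 & v i3 < v i1]]) <-> ~~ good w.
Proof.
move=> uw; rewrite (goodPn uw); split.
- case=> i0 [i1 [i2 [i3 /= [h01 h12 h23 h3]]]].
  rewrite !nth_cat_rev; try lia.
  pose f i := if i < size w then i else (size w + size w - i).-1.
  rewrite -!/(f _) => /and3P[v20 v03 v31].
  have fw p : p < size w + size w -> f p < size w by rewrite /f; case: ifP; lia.
  (* Folding the doubled word onto [w] makes positions rise and then fall, so among three chosen
     positions the middle one is never strictly leftmost in [w]. *)
  have unimodal p q s : p < q -> q < s -> minn (f p) (f s) <= f q.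
    by rewrite /f; do 3![case: ifP]; lia.
  have ne p q : nth 0 w p < nth 0 w q -> p <> q.
    by move=> + E; rewrite E ltnn.
  have n20 := ne _ _ v20; have n03 := ne _ _ v03; have n31 := ne _ _ v31.
  have n23 := ne _ _ (ltn_trans v20 v03).
  have n01 := ne _ _ (ltn_trans v03 v31).
  have n21 := ne _ _ (ltn_trans (ltn_trans v20 v03) v31).
  have u012 := unimodal _ _ _ h01 h12; have u123 := unimodal _ _ _ h12 h23.
  have u013 := unimodal _ _ _ h01 (ltn_trans h12 h23).
  have u023 := unimodal _ _ _ (ltn_trans h01 h12) h23.
  have w0 := fw i0; have w1 := fw i1; have w2 := fw i2; have w3 := fw i3.
  move: {fw ne unimodal} f v20 v03 v31 n20 n03 n31 n23 n01 n21
    u012 u123 u013 u023 w0 w1 w2 w3 => f.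
  move: (f i0) (f i1) (f i2) (f i3) => f0 f1 f2 f3.
  move=> v20 v03 v31 n20 n03 n31 n23 n01 n21 u012 u123 u013 u023 w0 w1 w2 w3.
  (* The leftmost folded letter is an end of the occurrence, 2 or 3, and serves as [i]. The next one
     is an end of the remaining three. With 2 removed, the middle letter 1 and the later of 4 and 3
     are at distance at least two; with 3 removed, the middle letter 4 and the later of 2 and 1
     are. *)
  have [lt03|le30] := ltnP f0 f3.
  + have [lt13|le31] := ltnP f1 f3.
    * by exists f0, f2, f3; split; lia.
    * by exists f0, f2, f1; split; lia.
  + have [lt02|le20] := ltnP f0 f2.
    * by exists f3, f2, f1; split; lia.
    * by exists f3, f0, f1; split; lia.
- case=> i [j [k [ij ik /andP[vj vk]]]].
  have nth1 p : p < size w -> nth 0 (w ++ rev w) p = nth 0 w p.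
    by move=> hp; rewrite nth_cat hp.
  (* The mirror image of position [p] in the reversed half. *)
  pose c p := (size w + size w - p).-1.
  have nth2 p : p < size w -> nth 0 (w ++ rev w) (c p) = nth 0 w p.
    move=> hp; rewrite nth_cat_rev /c; last by lia.
    by rewrite ifF; [congr nth|]; lia.
  have cE p : c p = (size w + size w - p).-1 by [].
  have ne p q : p < q < size w -> nth 0 w p <> nth 0 w q.
    by case/andP=> pq qw /eqP; rewrite nth_uniq ?(ltn_trans pq) ?(ltn_eqF pq).
  have njk : j <> k by move=> E; move: vj vk; rewrite E; lia.
  have nih := ne i i.+1; have nhj := ne i.+1 j; have nhk := ne i.+1 k.
  have iw : i < size w by lia.
  have hw : i.+1 < size w by lia.
  have /andP[_ jw] := ij; have /andP[_ kw] := ik.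
  have V := (nth1 _ iw, nth1 _ hw, nth1 _ jw, nth1 _ kw,
             nth2 _ iw, nth2 _ hw, nth2 _ jw, nth2 _ kw).
  clearbody c.
  (* The letter at [i] plays 2 if it is below its right neighbour and 3 otherwise. The neighbour's
     rank then fixes all four roles, and the order of [j] and [k] decides which letters are read in
     the reversed half: eight patterns in all. *)
  have [ltih|ltih] := ltnP (nth 0 w i) (nth 0 w i.+1).
  + have [lthk|lthk] := ltnP (nth 0 w i.+1) (nth 0 w k);
      have [jk|jk] := ltnP j k.
    * exists i, k, (c j), (c i.+1) => /=.
      by rewrite !V !cE; split; lia.
    * exists i, k, j, (c i.+1) => /=.
      by rewrite !V !cE; split; lia.
    * exists i, i.+1, j, k => /=.
      by rewrite !V; split; lia.
    * exists i, i.+1, j, (c k) => /=.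
      by rewrite !V !cE; split; lia.
  + have [lthj|lthj] := ltnP (nth 0 w i.+1) (nth 0 w j);
      have [jk|jk] := ltnP j k.
    * exists j, k, (c i.+1), (c i) => /=.
      by rewrite !V !cE; split; lia.
    * exists j, (c k), (c i.+1), (c i) => /=.
      by rewrite !V !cE; split; lia.
    * exists i.+1, k, (c j), (c i) => /=.
      by rewrite !V !cE; split; lia.
    * exists i.+1, k, j, (c i) => /=.
      by rewrite !V !cE; split; lia.
Qed.

(** * Permutations as words on an interval, and the count *)

Lemma nth_values_word (n : nat) (s : 'S_n) (i : 'I_n) :
  nth 0 (values (word_of_perm s)) i = s i.
Proof. by rewrite nth_values tnth_mktuple. Qed.

Lemma values_word_inj (n : nat) :
  injective (fun s : 'S_n => values (word_of_perm s)).
Proof.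
move=> s t E; apply/permP=> i; apply: val_inj => /=.
by rewrite -!nth_values_word E.
Qed.

Lemma interval_values_word (n : nat) (s : 'S_n) :
  interval_word 0 n (values (word_of_perm s)).
Proof.
split=> [|y].
  rewrite map_inj_uniq; last exact: val_inj.
  by rewrite map_inj_uniq ?enum_uniq //; exact: perm_inj.
apply/idP/idP=> [/mapP[x _ ->]|/= lt_yn]; first exact: ltn_ord.
have -> : y = s ((s^-1)%g (Ordinal lt_yn)) by rewrite permKV.
by rewrite -nth_values_word mem_nth // size_values.
Qed.

Lemma interval_word_values (n : nat) (w : seq nat) :
  interval_word 0 n w -> exists s : 'S_n, w = values (word_of_perm s).
Proof.
move=> iw; have sw := interval_word_size iw; case: iw => uw mw.
have lt_w (i : 'I_n) : nth 0 w i < n.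
  by have := mem_nth 0 (s := w) (n := i); rewrite sw mw => /(_ (ltn_ord i)).
have inj : injective (fun i : 'I_n => Ordinal (lt_w i)).
  move=> i j /(congr1 val) /eqP /=; rewrite nth_uniq ?sw ?ltn_ord //.
  by move/eqP/val_inj.
exists (perm inj); apply: (@eq_from_nth _ 0); rewrite ?size_values // sw.
move=> i lt_in; rewrite -[i]/(val (Ordinal lt_in)) nth_values_word.
by rewrite permE.
Qed.

Lemma avoids2413_good (n : nat) (s : 'S_n) :
  avoids [tuple of word_of_perm s ++ rev (word_of_perm s)] perm2413 =
  good (values (word_of_perm s)).
Proof.
set w2 := tuple _.
have E : values w2 = values (word_of_perm s) ++ rev (values (word_of_perm s)).
  by rewrite /values /= map_cat map_rev.
have := occurrence2413_good (interval_values_word s).1.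
rewrite /= size_values -E -contains2413P /avoids => H.
by apply/negP/idP => [nc|gs /H]; [apply: contraT => /H|rewrite gs].
Qed.

(** Doubling is injective, so it suffices to count permutations with a good word; their words and
    the enumeration are duplicate-free lists with the same members. *)
Lemma r2413_good_words (n : nat) : r n perm2413 = size (good_words n 0).
Proof.
pose dbl (s : 'S_n) := [tuple of word_of_perm s ++ rev (word_of_perm s)].
have dbl_inj : injective dbl.
  move=> s t /(congr1 val) /= /eqP; rewrite eqseq_cat ?size_tuple //.
  by case/andP=> /eqP E _; apply: values_word_inj; rewrite /values /= E.
have -> : r n perm2413 =
    #|dbl @: [set s | good (values (word_of_perm s))]|.
  apply: eq_card => w; rewrite !inE; apply/andP/imsetP.
  - by case=> /imsetP[s _ ->]; rewrite avoids2413_good; exists s; rewrite ?inE.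
  - case=> s; rewrite inE => gs ->; rewrite avoids2413_good; split=> //.
    exact: imset_f.
rewrite card_imset // cardE -(size_map (fun s => values (word_of_perm s))).
apply/perm_size/uniq_perm; last 1 first.
- move=> w; apply/mapP/idP=> [[s]|].
  + rewrite mem_enum inE => gs ->.
    by apply: good_words_complete => //; exact: interval_values_word.
  + case/good_words_sound=> gw /interval_word_values[s E]; exists s => //.
    by rewrite mem_enum inE -E.
- by rewrite map_inj_uniq ?enum_uniq //; exact: values_word_inj.
- exact: uniq_good_words.
Qed.

Theorem theorem15 (n : nat) (hn : 3 <= n) :
  r n perm2413 = 2 * r (n - 1) perm2413 + 2 * r (n - 2) perm2413.
Proof.
case: n hn => [|[|[|n]]] // _; rewrite !subSS subn0 !r2413_good_words.
exact: size_good_words_rec.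
Qed.
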